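(* Let $\mathbb{F}$ be a field of characteristic zero, $T$ a finite group, $\sigma\in Z^2(T,\mathbb{F}^\times)$, $\tau:T\to T$ a map, and $\iota$ a $\tau$-homogeneous involution on the twisted group algebra $\mathbb{F}^\sigma T$ with its natural $T$-grading. Then $\mathrm{Id}_{T,\iota}(\mathbb{F}^\sigma T)$, the ideal of $T$-graded polynomial identities with involution of $\mathbb{F}^\sigma T$, is generated as a $T_{T,\iota}$-ideal by the elementary identities $f_{U,I,I',\theta,\theta'}$ where $U$ ranges over all finite nonempty sequences of elements of $T$ of length $|U|\le |T|$ and $(I,I',\theta,\theta')\in\mathscr{T}_U$.
   Context: $Z^2(T,\mathbb{F}^\times)$ is the set of maps $\sigma:T\times T\to\mathbb{F}^\times$ with $\sigma(u,v)\sigma(uv,w)=\sigma(u,vw)\sigma(v,w)$ for all $u,v,w\in T$. $\mathbb{F}^\sigma T$ is the associative algebra with basis $\{X_u\mid u\in T\}$ and product $X_uX_v=\sigma(u,v)X_{uv}$, with the natural $T$-grading in which $X_u$ has degree $u$. An involution is an $\mathbb{F}$-linear map $\iota$ with $\iota(xy)=\iota(y)\iota(x)$ and $\iota(\iota(x))=x$; it is $\tau$-homogeneous if it maps the component of degree $g$ into the component of degree $\tau(g)$ for all $g\in T$. For $\mathbb{F}^\sigma T$ the map $\tau$ is then automatically an antiautomorphism of $T$ with $\tau\circ\tau=\mathrm{id}_T$. Free algebra: let $X^T=\bigcup_{g\in T}\{x_1^{(g)},x_2^{(g)},\ldots\}$. The free $T$-graded associative algebra with $\tau$-homogeneous involution,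 $\mathbb{F}\langle X^T,\iota\rangle$, is the free (non-unital) associative algebra on the symbols $x_i^{(g)}$ and $\iota(x_i^{(g)})$ ($g\in T$, $i\geq 1$), graded by $\deg x_i^{(g)}=g$, $\deg \iota(x_i^{(g)})=\tau(g)$, with the involution $\iota$ that interchanges $x_i^{(g)}$ and $\iota(x_i^{(g)})$. An element of it is a $T$-graded polynomial identity with involution of $\mathbb{F}^\sigma T$ if it vanishes under every substitution of each $x_i^{(g)}$ by an element of degree-$g$ component of $\mathbb{F}^\sigma T$ (with the symbol $\iota$ interpreted as the given involution); $\mathrm{Id}_{T,\iota}(\mathbb{F}^\sigma T)$ is the set of all these. A $T_{T,\iota}$-ideal is a two-sided ideal of $\mathbb{F}\langle X^T,\iota\rangle$ that is stable under $\iota$ and under all degree-preserving algebra endomorphisms commuting with $\iota$; the $T_{T,\iota}$-ideal generated by a set is the smallest one containing it. Elementary identities: for $U=(u_1,\ldots,u_m)\in T^m$ (with length $|U|=m$), let $\mathscr{T}_U$ be the set of all $(I,I',\theta,\theta')$ with $I=(i_1,\ldots,i_m),\ I'=(i_1',\ldots,i_m')\in\{0,1\}^m$ and $\theta,\theta'$ in the symmetric group $\mathcal{S}_m$ such that $$\tau^{i'_{\theta'(1)}}(u_{\theta'(1)})\cdots\tau^{i'_{\theta'(m)}}(u_{\theta'(m)})=\tau^{i_{\theta(1)}}(u_{\theta(1)})\cdots\tau^{i_{\theta(m)}}(u_{\theta(m)}).$$ For such data there is a unique scalar $\alpha=\alpha_{U,I,I',\theta,\theta'}\in\mathbb{F}$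 with $$\iota^{i'_{\theta'(1)}}(X_{u_{\theta'(1)}})\cdots\iota^{i'_{\theta'(m)}}(X_{u_{\theta'(m)}})=\alpha\,\iota^{i_{\theta(1)}}(X_{u_{\theta(1)}})\cdots\iota^{i_{\theta(m)}}(X_{u_{\theta(m)}})$$ in $\mathbb{F}^\sigma T$. Writing $z_k=x_k^{(u_k)}$, set $$f_{U,I,I',\theta,\theta'}=\iota^{i'_{\theta'(1)}}(z_{\theta'(1)})\cdots\iota^{i'_{\theta'(m)}}(z_{\theta'(m)})-\alpha\,\iota^{i_{\theta(1)}}(z_{\theta(1)})\cdots\iota^{i_{\theta(m)}}(z_{\theta(m)}).$$ Here $\iota^0$ and $\tau^0$ are identity maps. *)

(* Defs.v *)
From HB Require Import structures.
From mathcomp Require Import all_boot all_fingroup all_algebra.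
From mathcomp.finmap Require Import finmap.
From mathcomp.multinomials Require Import monalg.

Set Implicit Arguments.
Unset Strict Implicit.
Unset Printing Implicit Defensive.

Import GRing.Theory.
Local Open Scope ring_scope.

(** * Twisted group algebras *)

(* The set Z^2(T, F^x) of 2-cocycles with values in the unit group of F. *)
Record cocycle2 (F : fieldType) (T : finGroupType) := Cocycle2 {
  cocycle2_fun :> T -> T -> F;
  cocycle2_neq0 : forall u v, cocycle2_fun u v != 0;
  cocycle2P : forall u v w : T,
    cocycle2_fun u v * cocycle2_fun (u * v)%g w =
    cocycle2_fun u (v * w)%g * cocycle2_fun v w
}.

(* An alias of {ffun T -> F^o} inheriting only its vector space structure: the
   ring structure put on it below is the twisted one, not the pointwise one. *)
Definition tgalg (F : fieldType) (T : finGroupType) (sigma : cocycle2 F T) :=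
  {ffun T -> F^o}.

Section TwistedGroupAlgebra.
Variables (F : fieldType) (T : finGroupType) (sigma : cocycle2 F T).
Local Notation A := (tgalg sigma).

HB.instance Definition _ := GRing.Lmodule.on A.

Implicit Types (a b c : A) (u v w : T).

Definition tgX u : A := [ffun g => (g == u)%:R].

Definition tgmul a b : A :=
  \sum_u \sum_v (a u * b v * sigma u v) *: tgX (u * v)%g.

(* The cocycle is not assumed normalized, so the unit is not tgX 1. *)
Definition tgone : A := (sigma 1%g 1%g)^-1 *: tgX 1%g.

Lemma tgXE a : a = \sum_u a u *: tgX u.
Proof.
apply/ffunP=> g; rewrite sum_ffunE (bigD1 g) //= big1 => [|u ug].
  by rewrite !ffunE eqxx addr0 [RHS]mulr1.
by rewrite !ffunE eq_sym (negbTE ug) [LHS]mulr0.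
Qed.

Lemma tgZE k a u : (k *: a) u = k * a u.
Proof. by rewrite ffunE. Qed.

Lemma tgmulDl : left_distributive tgmul +%R.
Proof.
move=> a b c; rewrite /tgmul -big_split; apply: eq_bigr => u _ /=.
rewrite -big_split; apply: eq_bigr => v _ /=.
by rewrite -scalerDl ffunE !mulrDl.
Qed.

Lemma tgmulDr : right_distributive tgmul +%R.
Proof.
move=> a b c; rewrite /tgmul -big_split; apply: eq_bigr => u _ /=.
rewrite -big_split; apply: eq_bigr => v _ /=.
by rewrite -scalerDl ffunE mulrDr mulrDl.
Qed.

Lemma tgscaleAl k a b : k *: tgmul a b = tgmul (k *: a) b.
Proof.
rewrite /tgmul scaler_sumr; apply: eq_bigr => u _.
rewrite scaler_sumr; apply: eq_bigr => v _.
by rewrite scalerA tgZE !mulrA.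
Qed.

Lemma tgscaleAr k a b : k *: tgmul a b = tgmul a (k *: b).
Proof.
rewrite /tgmul scaler_sumr; apply: eq_bigr => u _.
rewrite scaler_sumr; apply: eq_bigr => v _.
by rewrite scalerA tgZE !mulrA [k * a u]mulrC.
Qed.

Lemma tgmulX u v : tgmul (tgX u) (tgX v) = sigma u v *: tgX (u * v)%g.
Proof.
rewrite /tgmul (bigD1 u) //= [X in _ + X]big1 ?addr0 => [|u' u'u]; last first.
  by rewrite big1 // => v' _; rewrite ffunE (negbTE u'u) !mul0r scale0r.
rewrite (bigD1 v) //= [X in _ + X]big1 ?addr0 => [|v' v'v]; last first.
  by rewrite [X in _ * X * _]ffunE (negbTE v'v) mulr0 mul0r scale0r.
by rewrite !ffunE !eqxx !mul1r.
Qed.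

Lemma tgmul0l a : tgmul 0 a = 0.
Proof. by rewrite -(scale0r (0 : A)) -tgscaleAl !scale0r. Qed.

Lemma tgmul0r a : tgmul a 0 = 0.
Proof. by rewrite -(scale0r (0 : A)) -tgscaleAr !scale0r. Qed.

Lemma tgmul_suml (f : T -> A) b :
  tgmul (\sum_u f u) b = \sum_u tgmul (f u) b.
Proof.
by apply: (big_morph (tgmul^~ b)) => [x y|]; rewrite ?tgmulDl ?tgmul0l.
Qed.

Lemma tgmul_sumr a (f : T -> A) :
  tgmul a (\sum_u f u) = \sum_u tgmul a (f u).
Proof. by apply: (big_morph (tgmul a)) => [x y|]; rewrite ?tgmulDr ?tgmul0r. Qed.

Lemma tgmulA : associative tgmul.
Proof.
have H1 u v w : tgmul (tgX u) (tgmul (tgX v) (tgX w)) =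
                tgmul (tgmul (tgX u) (tgX v)) (tgX w).
  rewrite !tgmulX -tgscaleAl -tgscaleAr !tgmulX !scalerA mulgA.
  by rewrite cocycle2P mulrC.
have H2 u v c : tgmul (tgX u) (tgmul (tgX v) c) = tgmul (tgmul (tgX u) (tgX v)) c.
  rewrite (tgXE c) (tgmul_sumr (tgX v)) (tgmul_sumr (tgX u)).
  rewrite (tgmul_sumr (tgmul _ _)); apply: eq_bigr => w _.
  by rewrite -!tgscaleAr H1.
have H3 u b c : tgmul (tgX u) (tgmul b c) = tgmul (tgmul (tgX u) b) c.
  rewrite (tgXE b) (tgmul_suml _ c) !(tgmul_sumr (tgX u)) (tgmul_suml _ c).
  by apply: eq_bigr => v _; rewrite -tgscaleAl -!tgscaleAr -tgscaleAl H2.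
move=> a b c; rewrite (tgXE a) (tgmul_suml _ (tgmul b c)) (tgmul_suml _ b).
rewrite (tgmul_suml _ c).
by apply: eq_bigr => u _; rewrite -!tgscaleAl H3.
Qed.

Lemma cocycle2_1l u : sigma 1%g u = sigma 1%g 1%g.
Proof.
have := cocycle2P sigma 1%g 1%g u; rewrite mulg1 mul1g => /mulIf->//.
exact: cocycle2_neq0.
Qed.

Lemma cocycle2_1r u : sigma u 1%g = sigma 1%g 1%g.
Proof.
have := cocycle2P sigma u 1%g 1%g; rewrite !mulg1 => /mulfI->//.
exact: cocycle2_neq0.
Qed.

Lemma tgmul1l : left_id tgone tgmul.
Proof.
move=> a; rewrite [in LHS](tgXE a) tgmul_sumr [RHS]tgXE; apply: eq_bigr => u _.
rewrite -tgscaleAr -tgscaleAl tgmulX cocycle2_1l mul1g scalerA.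
by rewrite scalerA mulfVK ?cocycle2_neq0.
Qed.

Lemma tgmul1r : right_id tgone tgmul.
Proof.
move=> a; rewrite [in LHS](tgXE a) tgmul_suml [RHS]tgXE; apply: eq_bigr => u _.
rewrite -tgscaleAl -tgscaleAr tgmulX cocycle2_1r mulg1 scalerA.
by rewrite scalerA mulfVK ?cocycle2_neq0.
Qed.

Lemma tgone_neq0 : tgone != 0.
Proof.
apply/eqP=> /ffunP/(_ 1%g)/eqP; rewrite !ffunE eqxx [_ *: _]mulr1 invr_eq0.
by rewrite (negbTE (cocycle2_neq0 sigma _ _)).
Qed.

HB.instance Definition _ := GRing.Zmodule_isNzRing.Build A
  tgmulA tgmul1l tgmul1r tgmulDl tgmulDr tgone_neq0.
HB.instance Definition _ := GRing.Lmodule_isLalgebra.Build F A tgscaleAl.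
HB.instance Definition _ := GRing.Lalgebra_isAlgebra.Build F A tgscaleAr.

Lemma tgX_mul u v : tgX u * tgX v = sigma u v *: tgX (u * v)%g.
Proof. exact: tgmulX. Qed.

Definition tg_homog (g : T) (a : A) : Prop := exists c : F, a = c *: tgX g.

End TwistedGroupAlgebra.

Definition is_involution (F : fieldType) (A : algType F)
    (iota : {linear A -> A}) : Prop :=
  {morph iota : x y / x * y >-> y * x} /\ involutive iota.

Definition tau_homogeneous (F : fieldType) (T : finGroupType)
    (sigma : cocycle2 F T) (tau : T -> T)
    (iota : {linear tgalg sigma -> tgalg sigma}) : Prop :=
  forall (g : T) (a : tgalg sigma), tg_homog g a -> tg_homog (tau g) (iota a).

(** * The free graded algebra with involution *)

(* (g, i, false) stands for x_i^(g) and (g, i, true) for iota(x_i^(g)); the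
   indices i start from 0. *)
Definition symb (T : finGroupType) : choiceType := (T * nat * bool)%type.

(* The free unital algebra on the symbols; the free (non-unital) algebra
   [freealg] is its subspace of elements without constant term. *)
Notation ufreealg F T := {malg F[{fmonom (symb T)}]}.

Section FreeAlgebra.
Variables (F : fieldType) (T : finGroupType).
Local Notation U := (ufreealg F T).
Implicit Types (w : {fmonom (symb T)}) (p q : U) (g : T) (i : nat).

Definition symb_star (s : symb T) : symb T := (s.1, ~~ s.2).

Definition word_star w : {fmonom (symb T)} :=
  FMonom (rev [seq symb_star s | s <- w]).

Definition ustar p : U := \sum_(w <- msupp p) << p@_w *g word_star w >>.

Definition ugen g i : U := << fmu ((g, i, false) : symb T) >>.

Definition noconst : {pred U} := [pred p : U | p@_mone == 0].

Lemma noconst_submod : submod_closed noconst.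
Proof.
split=> [|k p q]; rewrite !inE ?mcoeff0 // => /eqP p0 /eqP q0.
by rewrite mcoeffD mcoeffZ p0 q0 mulr0 addr0.
Qed.

HB.instance Definition _ :=
  GRing.isSubmodClosed.Build F U noconst noconst_submod.

Record freealg := FreeAlg { freealg_val :> U; _ : freealg_val \in noconst }.

HB.instance Definition _ := [isSub for freealg_val].
HB.instance Definition _ := [Choice of freealg by <:].
HB.instance Definition _ := [SubChoice_isSubZmodule of freealg by <:].
HB.instance Definition _ := [SubZmodule_isSubLmodule of freealg by <:].

Lemma noconst_mul p q : p \in noconst -> p * q \in noconst.
Proof. by rewrite !inE rmorphM /= => /eqP->; rewrite mul0r. Qed.

Lemma noconst_star p : p \in noconst -> ustar p \in noconst.
Proof.
rewrite !inE => /eqP p0; rewrite /ustar raddf_sum big_seq big1 //= => w wp.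
rewrite mcoeffU; case: eqP => // w1; suff w0 : w = mone by rewrite w0 p0.
apply: val_inj; have := congr1 (size \o val) w1.
by rewrite /= fm1 size_rev size_map /= => /size0nil.
Qed.

Definition fmul (f h : freealg) : freealg :=
  FreeAlg (noconst_mul h (valP f)).

Definition fstar (f : freealg) : freealg := FreeAlg (noconst_star (valP f)).

End FreeAlgebra.

Section GradingAndIdeals.
Variables (F : fieldType) (T : finGroupType) (tau : T -> T).
Local Notation L := (freealg F T).

Definition symb_deg (s : symb T) : T := if s.2 then tau s.1.1 else s.1.1.

Definition word_deg (w : {fmonom (symb T)}) : T :=
  (\prod_(s <- (w : seq (symb T))) symb_deg s)%g.

Definition free_homog (g : T) (f : L) : Prop :=
  forall w : {fmonom (symb T)}, w \in msupp f -> word_deg w = g.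

Definition graded_star_endo (phi : {linear L -> L}) : Prop :=
  [/\ {morph phi : f h / fmul f h},
      forall g f, free_homog g f -> free_homog g (phi f)
    & forall f, phi (fstar f) = fstar (phi f)].

Record is_Tideal (J : L -> Prop) : Prop := IsTideal {
  Tideal0 : J 0;
  TidealD : forall f h, J f -> J h -> J (f + h);
  TidealZ : forall (k : F) f, J f -> J (k *: f);
  TidealMl : forall f h, J h -> J (fmul f h);
  TidealMr : forall f h, J f -> J (fmul f h);
  Tideal_star : forall f, J f -> J (fstar f);
  Tideal_endo : forall phi : {linear L -> L},
    graded_star_endo phi -> forall f, J f -> J (phi f)
}.

Definition Tideal_gen (S : L -> Prop) (f : L) : Prop :=
  forall J : L -> Prop, is_Tideal J -> (forall h, S h -> J h) -> J f.

End GradingAndIdeals.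

(** * Graded identities with involution of a twisted group algebra *)

Section Identities.
Variables (F : fieldType) (T : finGroupType) (sigma : cocycle2 F T).
Variables (tau : T -> T) (iota : {linear tgalg sigma -> tgalg sigma}).
Local Notation A := (tgalg sigma).

(* [subst g i] is the element substituted for x_i^(g). *)
Definition symb_eval (subst : T -> nat -> A) (s : symb T) : A :=
  iter s.2 iota (subst s.1.1 s.1.2).

Definition word_eval (subst : T -> nat -> A) (w : {fmonom (symb T)}) : A :=
  \prod_(s <- (w : seq (symb T))) symb_eval subst s.

Definition free_eval (subst : T -> nat -> A) (f : freealg F T) : A :=
  mmap (in_alg A) (word_eval subst) (val f).

Definition graded_identity (f : freealg F T) : Prop :=
  forall subst : T -> nat -> A,
    (forall g i, tg_homog g (subst g i)) -> free_eval subst f = 0.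

Section Elementary.
Variables (m : nat) (U : m.-tuple T).
Implicit Types (I : m.-tuple bool) (theta : 'S_m).

Definition tau_prod I theta : T :=
  (\prod_(j < m) iter (tnth I (theta j)) tau (tnth U (theta j)))%g.

Definition iota_prod I theta : A :=
  \prod_(j < m) iter (tnth I (theta j)) iota (tgX sigma (tnth U (theta j))).

Definition free_prod I theta : ufreealg F T :=
  \prod_(j < m) iter (tnth I (theta j)) (@ustar F T)
                     (ugen F (tnth U (theta j)) (theta j)).

End Elementary.

(* The scalar alpha is uniquely determined by the equation it is required to
   satisfy, both products being nonzero homogeneous of the same degree. *)
Definition elementary_identity (f : freealg F T) : Prop :=
  exists (m : nat) (U : m.-tuple T) (I I' : m.-tuple bool)
         (theta theta' : 'S_m) (alpha : F),
    [/\ (0 < m <= #|T|)%N,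
        tau_prod U I' theta' = tau_prod U I theta,
        iota_prod U I' theta' = alpha *: iota_prod U I theta
      & val f = free_prod U I' theta' - alpha *: free_prod U I theta].

End Identities.

(* Main.v *)
(* A word in the symbols evaluated at x_i^(g) = X_g is a nonzero multiple of
   X_d, where d is its degree. Substituting x_i^(g) = t^(M^k(g,i)) X_g with k
   injective and M large separates the words by their letters counted with
   multiplicity, stars being ignored; hence an identity is a linear
   combination of binomials w' - a w, where w and w' have the same degree and
   the same letters up to order and stars.

   Such binomials are reduced to length at most n = #|T| by induction on their
   length k > n. Two of the n + 1 first nonempty prefixes of w have the same
   degree, so w = P E Q with P and E nonempty and E of degree 1. Modulo the
   identities of length at most 2, the loop E can be moved anywhere, rotated
   cyclically, and replaced with its image under the involution. In w' some
   letter x outside E is adjacent to a letter y of E; moving E next to x one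
   makes x and y adjacent in w too, in an order and with stars such that the
   two adjacent pairs agree up to the involution. Replacing the pair with one
   letter shortens both words. *)

From HB Require Import structures.
Require Import Defs.
From mathcomp Require Import all_boot all_fingroup all_algebra zify.
From mathcomp.finmap Require Import finmap.
From mathcomp.multinomials Require Import monalg.

Set Implicit Arguments.
Unset Strict Implicit.
Unset Printing Implicit Defensive.

Import GRing.Theory.
Local Open Scope ring_scope.

(** * Linear maps on monoid algebras *)

(* {malg F[K]} has no canonical algType structure for a noncommutative K. *)
Lemma malg_scaleAr (F : fieldType) (K : monomType) (k : F) (p q : {malg F[K]}) :
  k *: (p * q) = p * (k *: q).
Proof.
rewrite (malgME p q) (malgMEw (fsubset_refl _) (msuppZ_le k q)) scaler_sumr.
apply: eq_bigr => u _; rewrite scaler_sumr; apply: eq_bigr => v _.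
apply/malgP => w; rewrite !mcoeffZ !mcoeffU mulrCA.
by case: eqP; rewrite ?mulr1n ?mulr0n ?mulr0.
Qed.

Section LinearExtension.
Variables (F : fieldType) (K : choiceType) (V : lmodType F) (h : K -> V).
Implicit Types p q : {malg F[K]}.

Definition lext p : V := \sum_(w <- msupp p) p@_w *: h w.

Lemma lextEw (d : {fset K}) p :
  (msupp p `<=` d)%fset -> lext p = \sum_(w <- d) p@_w *: h w.
Proof.
move=> le; apply/big_fset_incl => // w _ /mcoeff_outdom ->.
by rewrite scale0r.
Qed.

Lemma lext_is_linear : linear lext.
Proof.
move=> k p q; pose d := (msupp (k *: p + q) `|` msupp p `|` msupp q)%fset.
have pqd : (msupp (k *: p + q) `<=` d)%fset by rewrite /d -fsetUA fsubsetUl.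
have pd : (msupp p `<=` d)%fset by rewrite /d fsetUAC fsubsetUr.
have qd : (msupp q `<=` d)%fset by rewrite /d fsubsetUr.
rewrite (lextEw pqd) (lextEw pd) (lextEw qd).
rewrite scaler_sumr -big_split; apply: eq_bigr => w _ /=.
by rewrite mcoeffD mcoeffZ scalerDl scalerA.
Qed.

HB.instance Definition _ :=
  GRing.isLinear.Build F {malg F[K]} V _ lext lext_is_linear.

Lemma lextU c w : lext << c *g w >> = c *: h w.
Proof.
by rewrite (@lextEw [fset w]%fset) ?msuppU_le // big_seq_fset1 mcoeffUU.
Qed.

Lemma malgU_scale c (w : K) : << c *g w >> = c *: << w >> :> {malg F[K]}.
Proof. by apply/malgP => k; rewrite mcoeffZ !mcoeffU mulr_natr. Qed.

End LinearExtension.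

Section LinearExtensionMorphism.
Variables (F : fieldType) (K : monomType) (A : lalgType F) (h : K -> A).
Hypothesis scaleAr : forall (k : F) (a b : A), k *: (a * b) = a * (k *: b).
Implicit Types p q : {malg F[K]}.

(** Commutation of scalars with the right factor is a hypothesis so that the target can be the
    twisted group algebra or the monoid algebra itself. *)
Lemma lextM : {morph h : u v / mmul u v >-> u * v} ->
  {morph lext h : p q / p * q}.
Proof.
move=> hM p q; rewrite malgME linear_sum {2}/lext mulr_suml.
apply: eq_bigr => u _; rewrite linear_sum mulr_sumr.
apply: eq_bigr => v _ /=.
by rewrite lextU hM -scalerAl -scaleAr scalerA.
Qed.
End LinearExtensionMorphism.

(* Locked, as unification would otherwise unfold the underlying finite maps. *)
HB.lock Definition mon (F : fieldType) (T : finGroupType) (s : seq (symb T)) :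
  ufreealg F T := << (FMonom s : {fmonom (symb T)}) >>.

(* The empty word, a nonzero constant, is sent to the junk value 0. *)
HB.lock Definition lw (F : fieldType) (T : finGroupType) (s : seq (symb T)) :
  freealg F T := insubd (0 : freealg F T) (mon F s).

(** * Words and stars in the free algebra *)

Section Words.
Variables (F : fieldType) (T : finGroupType).
Local Notation mon := (@mon F T).
Local Notation lw := (@lw F T).
Local Notation U := (ufreealg F T).
Local Notation L := (freealg F T).
Local Notation word := (seq (symb T)).
Implicit Types (s t : word) (p q : U) (f h : L).

Definition star s : word := rev (map (@symb_star T) s).

Lemma monE s : mon s = << (FMonom s : {fmonom (symb T)}) >>.
Proof. by rewrite mon.unlock. Qed.

Lemma monM s t : mon (s ++ t) = mon s * mon t.
Proof.
rewrite mon.unlock malgM_def fgmulUU mulr1; congr << _ >>.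
exact: esym (fmmulE (FMonom s) (FMonom t)).
Qed.

Lemma mon0 : mon [::] = 1.
Proof. by rewrite mon.unlock -fmoneE. Qed.

Lemma symb_starK : involutive (@symb_star T).
Proof. by case=> [[g i] b]; rewrite /symb_star /= negbK. Qed.

Lemma starK : involutive star.
Proof.
move=> s; rewrite /star map_rev revK -map_comp -[RHS]map_id.
by apply: eq_map => x /=; rewrite symb_starK.
Qed.

Lemma star_cat s t : star (s ++ t) = star t ++ star s.
Proof. by rewrite /star map_cat rev_cat. Qed.

Lemma size_star s : size (star s) = size s.
Proof. by rewrite size_rev size_map. Qed.

Lemma star_eq0 s : (star s == [::]) = (s == [::]).
Proof. by rewrite -!size_eq0 size_star. Qed.

Lemma val_lw s : s != [::] -> freealg_val (lw s) = mon s.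
Proof.
move=> s0; rewrite lw.unlock -[freealg_val _]/(val _) val_insubd inE mon.unlock mcoeffU.
by rewrite fmP fm1 (negbTE s0) eqxx.
Qed.

Lemma lw_mul s t : s != [::] -> t != [::] -> lw (s ++ t) = fmul (lw s) (lw t).
Proof.
move=> s0 t0; apply: val_inj; rewrite /= !val_lw ?monM //.
by case: s s0.
Qed.

Lemma ustar_lext p : ustar p = lext (fun w : {fmonom (symb T)} => mon (star w)) p.
Proof. by apply: eq_bigr => w _; rewrite malgU_scale mon.unlock. Qed.

Lemma ustar_mon s : ustar (mon s) = mon (star s).
Proof. by rewrite ustar_lext mon.unlock lextU scale1r. Qed.

Lemma ugenE g i : ugen F g i = mon [:: (g, i, false)].
Proof. by rewrite mon.unlock /ugen fmuE. Qed.

Lemma iter_ustar_ugen (b : bool) g i :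
  iter b (@ustar F T) (ugen F g i) = mon [:: (g, i, b)].
Proof. by case: b; rewrite /= ugenE // ustar_mon. Qed.

(** A polynomial without constant term is the combination of the nonempty words in its support, so
    linear facts reduce to such words. *)
Lemma freealg_ind (P : L -> Prop) :
  P 0 -> (forall f h, P f -> P h -> P (f + h)) ->
  (forall (k : F) f, P f -> P (k *: f)) ->
  (forall s, s != [::] -> P (lw s)) -> forall f, P f.
Proof.
move=> P0 PD PZ Pw f.
suff -> : f = \sum_(w <- msupp (val f)) (val f)@_w *: lw w.
  elim/big_ind: _ => // w _; case: (eqVneq (w : word) [::]) => [->|/Pw/PZ//].
  suff -> : lw [::] = 0 by rewrite scaler0.
  apply: val_inj; rewrite lw.unlock val_insubd inE mon.unlock mcoeffU fmP fm1 eqxx.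
  by rewrite oner_eq0.
apply: val_inj; rewrite raddf_sum /= {1}(monalgE (val f)) !big_seq.
apply: eq_bigr => w wf; rewrite malgU_scale; congr (_ *: _).
rewrite val_lw ?mon.unlock ?fmK; first by [].
apply: contraL wf => /eqP w0; rewrite -mcoeff_eq0.
have -> : w = mone by apply/eqP; rewrite fmP fm1 w0.
by have := valP f; rewrite inE.
Qed.

End Words.

(** * Evaluation of words and identities *)

Section HomogeneousInvolution.
Variables (F : fieldType) (T : finGroupType) (sigma : cocycle2 F T).
Variables (tau : T -> T) (iota : {linear tgalg sigma -> tgalg sigma}).
Hypothesis iota_inv : is_involution iota.
Hypothesis iota_tau : tau_homogeneous tau iota.
Local Notation A := (tgalg sigma).
Local Notation U := (ufreealg F T).
Local Notation L := (freealg F T).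
Local Notation word := (seq (symb T)).
Implicit Types (g : T) (a b : A) (s t : word) (p q : U) (f h : L) (sub : T -> nat -> A).

(** Excluding 0 makes the degree [g] unique, so that degrees can be read off from elements. *)
Definition nz_homog (g : T) a : Prop := exists2 c : F, c != 0 & a = c *: tgX sigma g.

Lemma tgX_coef u v : tgX sigma u v = (v == u)%:R.
Proof. by rewrite ffunE. Qed.

Lemma tgX_neq0 u : tgX sigma u != 0.
Proof. by apply/eqP=> /ffunP/(_ u)/eqP; rewrite !ffunE eqxx oner_eq0. Qed.

Lemma nz_homog_neq0 g a : nz_homog g a -> a != 0.
Proof. by case=> c c0 ->; rewrite scaler_eq0 negb_or c0 tgX_neq0. Qed.

Lemma nz_homogX g : nz_homog g (tgX sigma g).
Proof. by exists 1; rewrite ?oner_eq0 ?scale1r. Qed.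

Lemma nz_homogM g g' a b : nz_homog g a -> nz_homog g' b -> nz_homog (g * g')%g (a * b).
Proof.
move=> [c c0 ->] [d d0 ->]; exists (c * d * sigma g g').
  by rewrite !mulf_neq0 ?cocycle2_neq0.
by rewrite -scalerAl -scalerAr tgX_mul !scalerA.
Qed.

Lemma nz_homog1 : nz_homog 1%g (1 : A).
Proof. by exists (sigma 1%g 1%g)^-1; rewrite ?invr_neq0 ?cocycle2_neq0. Qed.

Lemma nz_homog_inj g g' a : nz_homog g a -> nz_homog g' a -> g = g'.
Proof.
move=> [c c0 ->] [d d0] /ffunP/(_ g); rewrite !tgZE !tgX_coef eqxx mulr1.
by case: eqVneq => // _ /eqP; rewrite mulr0 (negbTE c0).
Qed.

Lemma nz_homog_colinear g a b : nz_homog g a -> nz_homog g b ->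
  exists2 c, c != 0 & b = c *: a.
Proof.
move=> [c c0 ->] [d d0 ->]; exists (d / c); first by rewrite mulf_neq0 ?invr_neq0.
by rewrite scalerA divfK.
Qed.

Lemma homogW g a : nz_homog g a -> tg_homog g a.
Proof. by case=> c _ ->; exists c. Qed.

Lemma homogP g a : a != 0 -> tg_homog g a -> nz_homog g a.
Proof.
by move=> a0 [c ac]; exists c => //; apply: contraNneq a0 => c0; rewrite ac c0 scale0r.
Qed.

Lemma homogM g g' a b : tg_homog g a -> tg_homog g' b -> tg_homog (g * g')%g (a * b).
Proof.
move=> [c ->] [d ->]; exists (c * d * sigma g g').
by rewrite -scalerAl -scalerAr tgX_mul !scalerA.
Qed.

Lemma iotaM : {morph iota : x y / x * y >-> y * x}. Proof. exact: iota_inv.1. Qed.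

Lemma iotaK : involutive iota. Proof. exact: iota_inv.2. Qed.

Lemma iota1 : iota 1 = 1.
Proof. by rewrite -[LHS]mul1r -{1}(iotaK 1) -iotaM mul1r iotaK. Qed.

Lemma nz_homog_iota g a : nz_homog g a -> nz_homog (tau g) (iota a).
Proof.
move=> ga; apply: homogP; last exact/iota_tau/homogW.
by apply: contraNneq (nz_homog_neq0 ga) => ia0; rewrite -(iotaK a) ia0 linear0.
Qed.

(** That [tau] reverses products is derived: both sides are the degree of the nonzero element
    [iota (X_g X_g')]. *)
Lemma tauM g g' : tau (g * g')%g = (tau g' * tau g)%g.
Proof.
have [gX g'X] := (nz_homogX g, nz_homogX g').
have := nz_homogM (nz_homog_iota g'X) (nz_homog_iota gX); rewrite -iotaM.
exact/nz_homog_inj/nz_homog_iota/nz_homogM.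
Qed.

Lemma tauK : involutive tau.
Proof.
move=> g; have gX := nz_homogX g.
by have := nz_homog_iota (nz_homog_iota gX); rewrite iotaK => /nz_homog_inj; apply.
Qed.

Lemma tau1 : tau 1%g = 1%g.
Proof. by apply: (mulgI (tau 1%g)); rewrite -tauM !mulg1. Qed.

Definition deg s : T := (\prod_(x <- s) symb_deg tau x)%g.

Lemma deg0 : deg [::] = 1%g. Proof. by rewrite /deg big_nil. Qed.

Lemma deg_cat s t : deg (s ++ t) = (deg s * deg t)%g.
Proof. by rewrite /deg big_cat. Qed.

Lemma deg_cons x s : deg (x :: s) = (symb_deg tau x * deg s)%g.
Proof. by rewrite /deg big_cons. Qed.

Lemma deg1 x : deg [:: x] = symb_deg tau x.
Proof. by rewrite /deg big_seq1. Qed.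

Lemma symb_deg_star x : symb_deg tau (symb_star x) = tau (symb_deg tau x).
Proof. by case: x => [[g i] []]; rewrite /symb_deg /= ?tauK. Qed.

Lemma star_cons (x : symb T) s : star (x :: s) = star s ++ [:: symb_star x].
Proof. by rewrite /star /= rev_cons cats1. Qed.

Lemma deg_star s : deg (star s) = tau (deg s).
Proof.
elim: s => [|x s IH]; first by rewrite /deg !big_nil tau1.
by rewrite star_cons deg_cat IH deg1 symb_deg_star -tauM -deg_cons.
Qed.

Definition weval sub s : A := \prod_(x <- s) symb_eval iota sub x.

Lemma weval_cat sub s t : weval sub (s ++ t) = weval sub s * weval sub t.
Proof. by rewrite /weval big_cat. Qed.

Lemma weval_cons sub x s : weval sub (x :: s) = symb_eval iota sub x * weval sub s.
Proof. by rewrite /weval big_cons. Qed.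

Lemma weval1 sub x : weval sub [:: x] = symb_eval iota sub x.
Proof. by rewrite /weval big_seq1. Qed.

Lemma symb_eval_star sub x :
  symb_eval iota sub (symb_star x) = iota (symb_eval iota sub x).
Proof. by case: x => [[g i] []]; rewrite /symb_eval /= ?iotaK. Qed.

Lemma weval_star sub s : weval sub (star s) = iota (weval sub s).
Proof.
elim: s => [|x s IH]; first by rewrite /weval !big_nil iota1.
by rewrite star_cons weval_cat IH weval1 symb_eval_star -iotaM -weval_cons.
Qed.

Lemma weval_nz sub s : (forall g i, nz_homog g (sub g i)) ->
  nz_homog (deg s) (weval sub s).
Proof.
move=> subP; rewrite /deg /weval; elim/big_rec2: _ => [|[[g i] b] a e _].
  exact: nz_homog1.
apply: nz_homogM; case: b => //=; rewrite /symb_eval /symb_deg /=.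
  exact/nz_homog_iota.
exact: subP.
Qed.

Lemma weval_homog sub s : (forall g i, tg_homog g (sub g i)) ->
  tg_homog (deg s) (weval sub s).
Proof.
move=> subP; rewrite /deg /weval; elim/big_rec2: _ => [|[[g i] b] a e _].
  exact/homogW/nz_homog1.
apply: homogM; case: b => //=; rewrite /symb_eval /symb_deg /=.
  exact/iota_tau.
exact: subP.
Qed.

Lemma free_evalE sub f : free_eval iota sub f = lext (word_eval iota sub) (f : U).
Proof. by apply: eq_bigr => w _; rewrite mulr_algl. Qed.

Lemma free_eval0 sub : free_eval iota sub 0 = 0.
Proof. by rewrite free_evalE linear0. Qed.

Lemma free_evalD sub f h :
  free_eval iota sub (f + h) = free_eval iota sub f + free_eval iota sub h.
Proof. by rewrite !free_evalE linearD. Qed.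

Lemma free_evalZ sub (k : F) f :
  free_eval iota sub (k *: f) = k *: free_eval iota sub f.
Proof. by rewrite !free_evalE linearZ. Qed.

Lemma free_evalM sub f h :
  free_eval iota sub (fmul f h) = free_eval iota sub f * free_eval iota sub h.
Proof.
rewrite !free_evalE lextM // => [k a b|u v]; first exact: scalerAr.
by rewrite -[mmul u v]/(fmmul u v) fmmulE; apply: weval_cat.
Qed.

Lemma free_eval_lw sub s : s != [::] -> free_eval iota sub (lw F s) = weval sub s.
Proof. by move=> s0; rewrite free_evalE val_lw // mon.unlock lextU scale1r. Qed.

Lemma fstar_lw s : s != [::] -> fstar (lw F s) = lw F (star s).
Proof.
by move=> s0; apply: val_inj; rewrite /= (val_lw F s0) ustar_mon val_lw ?star_eq0.
Qed.

Lemma fstar_linear : linear (@fstar F T).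
Proof. by move=> k f h; apply: val_inj; rewrite /= !ustar_lext linearP. Qed.

Lemma free_eval_star sub f : free_eval iota sub (fstar f) = iota (free_eval iota sub f).
Proof.
elim/freealg_ind: f => [|f h fE hE|k f fE|s s0].
- have -> : fstar (0 : L) = 0 by apply: val_inj; rewrite /= ustar_lext linear0.
  by rewrite !free_eval0 linear0.
- have -> : fstar (f + h) = fstar f + fstar h.
    by have := fstar_linear 1 f h; rewrite !scale1r.
  by rewrite !free_evalD linearD fE hE.
- have -> : fstar (k *: f) = k *: fstar f.
    by apply: val_inj; rewrite /= !ustar_lext linearZ.
  by rewrite !free_evalZ linearZ fE.
by rewrite fstar_lw // !free_eval_lw ?star_eq0 // weval_star.
Qed.

Lemma free_eval_homog sub g f : (forall g i, tg_homog g (sub g i)) ->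
  free_homog tau g f -> tg_homog g (free_eval iota sub f).
Proof.
move=> subP fg; rewrite free_evalE /lext big_seq.
elim/big_ind: _ => [|a b [c ->] [d ->]|w /fg wg].
- by exists 0; rewrite scale0r.
- by exists (c + d); rewrite scalerDl.
have [c] : tg_homog (deg w) (word_eval iota sub w) by apply: weval_homog.
by rewrite [deg w]wg => ->; eexists; rewrite scalerA.
Qed.

Lemma free_homog_lw s : s != [::] -> free_homog tau (deg s) (lw F s).
Proof.
move=> s0 w; rewrite val_lw // mon.unlock => /(fsubsetP msuppU_le).
by rewrite in_fset1 => /eqP ->.
Qed.

(** An endomorphism that commutes with the star is determined by the images of the unstarred
    variables, so evaluating after it is again a substitution. *)
Lemma free_eval_endo sub (phi : {linear L -> L}) f : graded_star_endo tau phi ->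
  free_eval iota sub (phi f) =
  free_eval iota (fun g i => free_eval iota sub (phi (lw F [:: (g, i, false)]))) f.
Proof.
move=> [phiM _ phiS].
elim/freealg_ind: f => [|f h fE hE|k f fE|s s0].
- by rewrite linear0 !free_eval0.
- by rewrite linearD !free_evalD fE hE.
- by rewrite linearZ !free_evalZ fE.
rewrite [RHS]free_eval_lw //.
have E1 x : free_eval iota sub (phi (lw F [:: x])) =
    symb_eval iota (fun g i => free_eval iota sub (phi (lw F [:: (g, i, false)]))) x.
  case: x => [[g i] []] //=; rewrite /symb_eval /= -free_eval_star -phiS.
  by rewrite fstar_lw.
elim: s s0 => // x [|y s] IH _; first by rewrite weval1.
rewrite -cat1s (@lw_mul _ _ [:: x] (y :: s)) //.
by rewrite phiM free_evalM weval_cat IH // weval1 E1.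
Qed.

Lemma graded_identity_Tideal : is_Tideal tau (graded_identity iota).
Proof.
split.
- by move=> sub _; rewrite free_eval0.
- by move=> f h f0 h0 sub subP; rewrite free_evalD f0 // h0 // addr0.
- by move=> k f f0 sub subP; rewrite free_evalZ f0 // scaler0.
- by move=> f h h0 sub subP; rewrite free_evalM h0 // mulr0.
- by move=> f h f0 sub subP; rewrite free_evalM f0 // mul0r.
- by move=> f f0 sub subP; rewrite free_eval_star f0 // linear0.
move=> phi phiP f f0 sub subP; rewrite (free_eval_endo _ _ phiP) f0 // => g i.
apply: free_eval_homog => //; case: phiP => _ phig _; apply: phig.
by have := @free_homog_lw [:: (g, i, false)] isT; rewrite deg1.
Qed.

(** * Elementary identities as binomials in words *)

Lemma prod_mon1 m (x : 'I_m -> symb T) :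
  \prod_(j < m) mon F [:: x j] = mon F [seq x j | j <- enum 'I_m].
Proof.
rewrite [index_enum _]unlock -enumT; elim: (enum _) => [|j r IH].
  by rewrite big_nil mon0.
by rewrite big_cons IH -monM.
Qed.

Definition elem_word m (u : m.-tuple T) (I : m.-tuple bool) (theta : 'S_m) : word :=
  [seq (tnth u (theta j), val (theta j), tnth I (theta j)) | j <- enum 'I_m].

Lemma free_prodE m (u : m.-tuple T) I theta :
  free_prod F u I theta = mon F (elem_word u I theta).
Proof.
rewrite /elem_word -prod_mon1.
by apply: eq_bigr => j _; rewrite iter_ustar_ugen.
Qed.

(** Every variable occurs exactly once in the word, starred or not, so the product of the scalars
    does not depend on [I] or [theta]. *)
Lemma weval_elem_word m (u : m.-tuple T) I theta sub (c : T -> nat -> F) :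
  (forall g i, sub g i = c g i *: tgX sigma g) ->
  weval sub (elem_word u I theta) =
  (\prod_(k < m) c (tnth u k) k) *: iota_prod iota u I theta.
Proof.
move=> subE; rewrite (reindex_inj (@perm_inj _ theta)) /=.
rewrite /iota_prod -scaler_prod /weval big_map [index_enum _]unlock -enumT.
apply: eq_bigr => j _.
rewrite /symb_eval /= subE.
by case: (tnth I _); rewrite //= linearZ.
Qed.

Lemma size_elem_word m (u : m.-tuple T) I theta : size (elem_word u I theta) = m.
Proof. by rewrite size_map size_enum_ord. Qed.

Lemma elementary_graded_identity f :
  elementary_identity tau iota f -> graded_identity iota f.
Proof.
move=> [m [u [I [I' [th [th' [al [_ _ E fE]]]]]]]] sub subP.
(* The components of the grading are lines, so each substituted value is a multiple of a basis
   element. *)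
have subE g i : sub g i = sub g i g *: tgX sigma g.
  by have [c ->] := subP g i; rewrite tgZE tgX_coef eqxx mulr1.
have eval_mon s : lext (word_eval iota sub) (mon F s) = weval sub s.
  by rewrite mon.unlock lextU scale1r.
rewrite free_evalE -[freealg_val f]/(val f) fE !free_prodE linearB linearZ /=.
rewrite !eval_mon !(weval_elem_word _ _ _ subE) E scalerA mulrC -scalerA.
by rewrite subrr.
Qed.

End HomogeneousInvolution.

(** * Proportionality of words modulo a T-ideal *)

Lemma subr_scale_inv (F : fieldType) (V : lmodType F) (x y : V) (k : F) :
  k != 0 -> - k^-1 *: (y - k *: x) = x - k^-1 *: y.
Proof.
move=> k0; rewrite scalerBr scaleNr scalerA mulNr mulVf //.
by rewrite scaleN1r opprK addrC.
Qed.

Lemma subr_scale_trans (F : fieldType) (V : lmodType F) (x y z : V) (k l : F) :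
  z - l *: y + l *: (y - k *: x) = z - (l * k) *: x.
Proof. by rewrite scalerBr scalerA addrA subrK. Qed.

Lemma freealg_val_subZ (F : fieldType) (T : finGroupType) (f h : freealg F T) (k : F) :
  freealg_val (f - k *: h) = freealg_val f - k *: freealg_val h.
Proof. by []. Qed.

Section Congruence.
Variables (F : fieldType) (T : finGroupType) (sigma : cocycle2 F T).
Variables (tau : T -> T) (iota : {linear tgalg sigma -> tgalg sigma}).
Hypothesis iota_inv : is_involution iota.
Hypothesis iota_tau : tau_homogeneous tau iota.
Local Notation A := (tgalg sigma).
Local Notation U := (ufreealg F T).
Local Notation L := (freealg F T).
Local Notation word := (seq (symb T)).
Local Notation mon := (@mon F T).
Local Notation lw := (@lw F T).
Local Notation deg := (deg tau).
Implicit Types (s t : word) (p q : U) (f h : L).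

(** * Endomorphisms substituting words for variables *)

Section Substitution.
Variable sub : T -> nat -> word.
Hypothesis sub_deg : forall g i, deg (sub g i) = g.
Hypothesis sub_neq0 : forall g i, sub g i != [::].

Definition symb_subst (x : symb T) : word :=
  if x.2 then star (sub x.1.1 x.1.2) else sub x.1.1 x.1.2.

Definition word_subst s : word := flatten (map symb_subst s).

Lemma word_subst_cat s t : word_subst (s ++ t) = word_subst s ++ word_subst t.
Proof. by rewrite /word_subst map_cat flatten_cat. Qed.

Lemma word_subst_eq0 s : (word_subst s == [::]) = (s == [::]).
Proof.
case: s => [|x s] //; rewrite /word_subst /= -size_eq0 size_cat addn_eq0.
suff /negbTE-> : size (symb_subst x) != 0%N by [].
by rewrite size_eq0 /symb_subst; case: x.2; rewrite ?star_eq0 sub_neq0.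
Qed.

Lemma word_subst_star s : word_subst (star s) = star (word_subst s).
Proof.
elim: s => // x s IH; rewrite star_cons word_subst_cat IH.
rewrite -[x :: s]cat1s word_subst_cat star_cat; congr (_ ++ _).
rewrite /word_subst /= !cats0 /symb_subst.
by case: x => [[g i] []]; rewrite /= ?starK.
Qed.

Lemma deg_word_subst s : deg (word_subst s) = deg s.
Proof.
elim: s => // x s IH; rewrite -cat1s word_subst_cat !deg_cat IH deg1 deg0 mulg1.
congr (_ * _)%g; rewrite /symb_subst /symb_deg.
by case: x.2; rewrite ?(deg_star iota_inv iota_tau) sub_deg.
Qed.

Definition subst_endo f : L :=
  lext (fun w : {fmonom (symb T)} => lw (word_subst w)) (f : U).

Lemma subst_endo_linear : linear subst_endo.
Proof. by move=> k f h; rewrite /subst_endo linearP. Qed.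

HB.instance Definition _ :=
  GRing.isLinear.Build F L L _ subst_endo subst_endo_linear.

Lemma subst_endo_lw s : s != [::] -> subst_endo (lw s) = lw (word_subst s).
Proof. by move=> s0; rewrite /subst_endo val_lw // mon.unlock lextU scale1r. Qed.

(** Words in [f] and their substitutes are nonempty, so [lw] may be replaced with [mon], whose
    products are those of the unital algebra. *)
Lemma val_subst_endo f :
  freealg_val (subst_endo f) =
  lext (fun w : {fmonom (symb T)} => mon (word_subst w)) (f : U).
Proof.
elim/freealg_ind: f => [|f h fE hE|k f fE|s s0].
- by rewrite !linear0.
- by rewrite !linearD /= fE hE.
- by rewrite !linearZ /= fE.
by rewrite subst_endo_lw // !val_lw ?word_subst_eq0 // mon.unlock lextU scale1r.
Qed.

Lemma subst_endoP : graded_star_endo tau subst_endo.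
Proof.
split.
- move=> f h; apply: val_inj; rewrite /= !val_subst_endo lextM // => [|u v].
    exact: malg_scaleAr.
  by rewrite -[mmul u v]/(fmmul u v) fmmulE word_subst_cat monM.
- move=> g f fg w; rewrite val_subst_endo; apply: contraTeq => wg.
  rewrite -mcoeff_eq0 /lext raddf_sum /= big_seq big1 // => v vf.
  rewrite mcoeffZ mon.unlock mcoeffU; case: eqP => [wE|_]; last by rewrite mulr0.
  case/eqP: wg; rewrite -wE -(fg v vf).
  exact: (deg_word_subst v).
move=> f; elim/freealg_ind: f => [|f h fE hE|k f fE|s s0].
- have -> : fstar (0 : L) = 0 by apply: val_inj; rewrite /= ustar_lext linear0.
  rewrite linear0; apply: val_inj; by rewrite /= ustar_lext linear0.
- have fD (a b : L) : fstar (a + b) = fstar a + fstar b.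
    by have := fstar_linear 1 a b; rewrite !scale1r.
  by rewrite linearD !fD linearD fE hE.
- have fZ a : fstar (k *: a) = k *: fstar a.
    by apply: val_inj; rewrite /= !ustar_lext linearZ.
  by rewrite linearZ /= !fZ linearZ fE.
rewrite fstar_lw //= !subst_endo_lw ?star_eq0 // word_subst_star.
by rewrite fstar_lw // word_subst_eq0.
Qed.

End Substitution.

(** * Words proportional modulo an ideal of identities *)

Variable J : L -> Prop.
Hypothesis JT : is_Tideal tau J.
Hypothesis J_elem : forall f, elementary_identity tau iota f -> J f.
Hypothesis J_id : forall f, J f -> graded_identity iota f.

(** Passing to the unital algebra lets the empty word act as a factor. *)
Definition inJ p : Prop := exists2 f : L, J f & freealg_val f = p.

Lemma inJ0 : inJ 0. Proof. by exists 0 => //; apply: Tideal0 JT. Qed.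

Lemma inJD p q : inJ p -> inJ q -> inJ (p + q).
Proof.
by move=> [f Jf <-] [h Jh <-]; exists (f + h) => //; apply: TidealD JT _ _ Jf Jh.
Qed.

Lemma inJZ k p : inJ p -> inJ (k *: p).
Proof. by move=> [f Jf <-]; exists (k *: f) => //; apply: TidealZ JT _ _ Jf. Qed.

Lemma inJMl s p : inJ p -> inJ (mon s * p).
Proof.
have [->|s0] := eqVneq s [::]; first by rewrite mon0 mul1r.
move=> [f Jf <-]; exists (fmul (lw s) f); first exact: (TidealMl JT (lw s) Jf).
by rewrite /= val_lw.
Qed.

Lemma inJMr s p : inJ p -> inJ (p * mon s).
Proof.
have [->|s0] := eqVneq s [::]; first by rewrite mon0 mulr1.
move=> [f Jf <-]; exists (fmul f (lw s)); first exact: (TidealMr JT (lw s) Jf).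
by rewrite /= val_lw.
Qed.

Definition basis_eval s : A := weval iota (fun g _ => tgX sigma g) s.

Lemma basis_eval_nz s : nz_homog (deg s) (basis_eval s).
Proof. exact: (weval_nz iota_inv iota_tau s (fun g _ => nz_homogX sigma g)). Qed.

Lemma inJ_basis_eval s t al : inJ (mon t - al *: mon s) ->
  basis_eval t = al *: basis_eval s.
Proof.
move=> [f /J_id f0 fE]; apply/eqP; rewrite -subr_eq0; apply/eqP.
have /f0 : forall g (i : nat), tg_homog g (tgX sigma g).
  by move=> g _; exists 1; rewrite scale1r.
rewrite free_evalE fE linearB linearZ /= mon.unlock !lextU !scale1r; exact.
Qed.

(** The scalar may be 0 here; [weq_coef] excludes that, since [t] would then vanish at the basis
    elements, where every word is nonzero. *)
Definition weq s t : Prop := exists al : F, inJ (mon t - al *: mon s).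

Lemma weq_refl s : weq s s.
Proof. by exists 1; rewrite scale1r subrr; apply: inJ0. Qed.

Lemma weq_coef s t al : inJ (mon t - al *: mon s) -> al != 0.
Proof.
move=> /inJ_basis_eval E; apply: contraTneq (nz_homog_neq0 (basis_eval_nz t)) => al0.
by rewrite E al0 scale0r eqxx.
Qed.

Lemma weq_deg s t : weq s t -> deg s = deg t.
Proof.
move=> [al Jst]; have [c c0 sE] := basis_eval_nz s.
apply: (@nz_homog_inj _ _ sigma _ _ (basis_eval t)); last exact: basis_eval_nz.
rewrite (inJ_basis_eval Jst) sE scalerA; exists (al * c) => //.
by rewrite mulf_neq0 // (weq_coef Jst).
Qed.

Lemma weq_sym s t : weq s t -> weq t s.
Proof.
move=> [al Jst]; exists al^-1; have := inJZ (- al^-1) Jst.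
by rewrite (subr_scale_inv _ _ (weq_coef Jst)).
Qed.

Lemma weq_trans t s r : weq s t -> weq t r -> weq s r.
Proof.
move=> [al Jst] [be Jtr]; exists (be * al); have := inJD Jtr (inJZ be Jst).
by rewrite subr_scale_trans.
Qed.

Lemma weq_cat s s' t t' : weq s s' -> weq t t' -> weq (s ++ t) (s' ++ t').
Proof.
move=> [al Js] [be Jt]; apply: (@weq_trans (s' ++ t)).
  by exists al; have := inJMr t Js; rewrite mulrBl -scalerAl -!monM.
by exists be; have := inJMl s' Jt; rewrite mulrBr -malg_scaleAr -!monM.
Qed.

(* In a pattern, (i, b) stands for the block B i, starred if b is true. *)
Definition lit (B : nat -> word) (x : nat * bool) : word :=
  if x.2 then star (B x.1) else B x.1.

Definition flat B (p : seq (nat * bool)) : word := flatten (map (lit B) p).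

Lemma flat_cat B (p p' : seq (nat * bool)) : flat B (p ++ p') = flat B p ++ flat B p'.
Proof. by rewrite /flat map_cat flatten_cat. Qed.

(** The blocks are substituted into an elementary identity with one variable for each position of
    [p]. A block may repeat: variables are numbered by positions and stay distinct. *)
Lemma weq_short B (p p' : seq (nat * bool)) :
    (forall i, B i != [::]) -> (size p <= #|T|)%N ->
    perm_eq (unzip1 p) (unzip1 p') -> deg (flat B p) = deg (flat B p') ->
  weq (flat B p) (flat B p').
Proof.
move=> B0 sz pp' dpp'.
have [p0|m0] := posnP (size p).
  have := perm_size pp'; rewrite !size_map p0 => /esym/size0nil ->.
  by rewrite (size0nil p0); apply: weq_refl.
set m := size p in sz m0.
have sz' : size p' == m by have /eqP := perm_size pp'; rewrite !size_map eq_sym.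
pose P := in_tuple p : m.-tuple _; pose P' := Tuple sz'.
(* [th'] matches each position of [p'] with a position of [p] holding the same block. *)
have /tuple_permP[th' thE] : perm_eq (map_tuple fst P') (map_tuple fst P).
  by rewrite perm_sym.
have {}thE j : (tnth P' j).1 = (tnth P (th' j)).1.
  have := congr1 (fun r => nth 0%N r j) thE.
  by rewrite -!tnth_nth !tnth_map tnth_ord_tuple => ->.
pose u := [tuple deg (B (tnth P j).1) | j < m].
pose I := [tuple (tnth P j).2 | j < m].
(* Stars are indexed by variables, not by positions in [p'], hence the inverse permutation. *)
pose I' := [tuple (tnth P' ((th'^-1)%g j)).2 | j < m].
(* Variables that do not occur in the identity are sent to themselves, which preserves degrees. *)
pose sub g i : word :=
  if insub i is Some j then
    if g == tnth u j then B (tnth P j).1 else [:: (g, i, false)]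
  else [:: (g, i, false)].
have subE (j : 'I_m) : sub (tnth u j) j = B (tnth P j).1.
  by rewrite /sub -[nat_of_ord j]/(val j) valK eqxx.
have sub_deg g i : deg (sub g i) = g.
  rewrite /sub; case: insubP => [j _ _|_]; last by rewrite deg1.
  by case: eqP => [->|_]; rewrite ?tnth_mktuple ?deg1.
have sub0 g i : sub g i != [::].
  by rewrite /sub; case: insubP => // j _ _; case: ifP; rewrite ?B0.
have E : word_subst sub (elem_word u I 1%g) = flat B p.
  rewrite /word_subst /flat -map_comp -[p]/(val P) -[val P]map_tnth_enum -map_comp.
  congr flatten; apply: eq_map => j /=.
  by rewrite /symb_subst /lit /= perm1 subE tnth_mktuple.
have E' : word_subst sub (elem_word u I' th') = flat B p'.
  rewrite /word_subst /flat -map_comp -[p']/(val P') -[val P']map_tnth_enum -map_comp.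
  congr flatten; apply: eq_map => j /=.
  by rewrite /symb_subst /lit /= subE thE tnth_mktuple permK.
have ew0 I1 th1 : elem_word u I1 th1 != [::].
  by rewrite -size_eq0 size_elem_word -lt0n.
have iE I1 th1 : iota_prod iota u I1 th1 = basis_eval (elem_word u I1 th1).
  rewrite /basis_eval (@weval_elem_word _ _ _ _ _ _ _ _ _ (fun _ _ => 1)).
    by rewrite big1 ?scale1r.
  by move=> g i; rewrite scale1r.
have tE I1 th1 : tau_prod tau u I1 th1 = deg (elem_word u I1 th1).
  rewrite /tau_prod /deg /elem_word big_map [index_enum _]unlock -enumT.
  apply: eq_bigr => j _; rewrite /symb_deg /=; by case: (tnth I1 _).
have dE : deg (elem_word u I' th') = deg (elem_word u I 1%g).
  by rewrite -(deg_word_subst sub_deg (elem_word u I' _)) E' -dpp' -E deg_word_subst.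
(* Nonzero elements of the same degree are proportional; the factor is the scalar of the elementary
   identity. *)
have [al al0 alE] := nz_homog_colinear (basis_eval_nz (elem_word u I 1%g))
  (eq_rect _ (fun g => nz_homog g _) (basis_eval_nz (elem_word u I' th')) _ dE).
exists al; exists (subst_endo sub (lw (elem_word u I' th') - al *: lw (elem_word u I 1%g))).
  apply: (Tideal_endo JT (subst_endoP sub_deg sub0)); apply: J_elem.
  exists m, u, I, I', 1%g, th', al; split.
  - by rewrite m0.
  - by rewrite !tE.
  - by rewrite !iE.
  by rewrite !free_prodE /= !val_lw.
rewrite (val_subst_endo sub0) freealg_val_subZ !val_lw // linearB linearZ /=.
have lextE r : lext (fun w : {fmonom (symb T)} => mon (word_subst sub w)) (mon r) =
    mon (word_subst sub r) by rewrite monE lextU scale1r.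
by rewrite !lextE E E'.
Qed.

End Congruence.

(** * Reduction to short words *)

Lemma adjacent_change (X : Type) (a : pred X) (s : seq X) :
  has a s -> has (predC a) s ->
  exists s1 x y s2, s = s1 ++ [:: x; y] ++ s2 /\ a x != a y.
Proof.
elim: s => // x [|y s] IH; first by rewrite /= !orbF => ->.
have [axy|axy _ _] := eqVneq (a x) (a y); last by exists [::], x, y, s.
move=> h1 h2; have [||s1 [x1 [y1 [s2 [-> a1]]]]] := IH.
- by move: h1; rewrite /= axy orbA orbb.
- by move: h2; rewrite /= axy orbA orbb.
by exists (x :: s1), x1, y1, s2.
Qed.

Lemma addn3_eq1 (a b c : nat) :
  (a + (b + c) = 1 -> 0 < b -> a = 0 /\ c = 0)%N.
Proof. lia. Qed.

(** * Words up to an abstract congruence *)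

Section Reduction.
Variables (T : finGroupType) (tau : T -> T).
Local Notation word := (seq (symb T)).
Local Notation pattern := (seq (nat * bool)).
Local Notation deg := (deg tau).
Hypothesis tau1 : tau 1%g = 1%g.
Hypothesis deg_star : forall s : word, deg (star s) = tau (deg s).
Variable R : word -> word -> Prop.
Hypothesis R_refl : forall s, R s s.
Hypothesis R_sym : forall s t, R s t -> R t s.
Hypothesis R_trans : forall t s r, R s t -> R t r -> R s r.
Hypothesis R_cat : forall s s' t t', R s s' -> R t t' -> R (s ++ t) (s' ++ t').
Hypothesis R_short : forall B (p p' : pattern),
  (forall i, B i != [::]) -> (size p <= #|T|)%N ->
  perm_eq (unzip1 p) (unzip1 p') -> deg (flat B p) = deg (flat B p') ->
  R (flat B p) (flat B p').
Implicit Types (s t : word) (p q : pattern) (B : nat -> word).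

(** An identity of length 1: [tau] fixes the neutral element, so [s] and its star have the same
    degree. *)
Lemma R_star s : deg s = 1%g -> R s (star s).
Proof.
move=> s1; have [->|s0] := eqVneq s [::]; first exact: R_refl.
have := @R_short (fun _ => s) [:: (0, false)] [:: (0, true)].
rewrite /flat /lit /= !cats0; apply=> //.
  by apply/card_gt0P; exists 1%g.
by rewrite deg_star s1 tau1.
Qed.

Lemma R_swap s t : deg (s ++ t) = deg (t ++ s) -> R (s ++ t) (t ++ s).
Proof.
move=> st; have [->|s0] := eqVneq s [::]; first by rewrite cats0.
have [->|t0] := eqVneq t [::]; first by rewrite cats0.
case: (leqP 2 #|T|) => [T2|T1].
  have := @R_short (fun i => if i == 0 then s else t)
    [:: (0, false); (1, false)] [:: (1, false); (0, false)].
  by rewrite /flat /lit /= !cats0; apply=> // i; case: ifP.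
(* No identity of length 2 is available here: s t ~ (s t)^* = t^* s^* ~ t s. *)
have eqT (g k : T) : g = k by apply: (card_le1_eqP (A := T) T1).
apply: (R_trans (R_star (eqT _ _))); rewrite star_cat.
by apply: R_cat; apply/R_sym/R_star/eqT.
Qed.

(** * Starring, rotating and moving loops *)

Definition flip (x : nat * bool) := (x.1, ~~ x.2).

Definition pattern_star p : pattern := rev (map flip p).

Lemma flipK : involutive flip.
Proof. by case=> i b; rewrite /flip /= negbK. Qed.

Lemma lit_flip B x : lit B (flip x) = star (lit B x).
Proof. by case: x => i []; rewrite /lit /= ?starK. Qed.

Lemma flat1 B x : flat B [:: x] = lit B x.
Proof. by rewrite /flat /= cats0. Qed.

Lemma flat_star B p : flat B (pattern_star p) = star (flat B p).
Proof.
elim: p => // x p IH; rewrite /pattern_star /= rev_cons -cats1 flat_cat.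
rewrite -[rev _]/(pattern_star p) IH flat1 lit_flip -cat1s flat_cat star_cat.
by rewrite flat1.
Qed.

Lemma unzip1_star p : perm_eq (unzip1 p) (unzip1 (pattern_star p)).
Proof.
by rewrite /pattern_star /unzip1 map_rev perm_sym perm_rev -map_comp.
Qed.

(** If [x] occurs in the loop only with the opposite star, the star of the whole loop, equivalent to
    the loop, contains [x] as prescribed. *)
Lemma loop_split B p (x : nat * bool) : deg (flat B p) = 1%g -> x.1 \in unzip1 p ->
  exists p1 p2, [/\ R (flat B p) (flat B (p1 ++ x :: p2)),
     deg (flat B (p1 ++ x :: p2)) = 1%g
    & perm_eq (unzip1 p) (unzip1 (p1 ++ x :: p2))].
Proof.
move=> p1 /mapP[y yp xy].
suff [q [xq Rq q1 pq]] : exists q, [/\ x \in q, R (flat B p) (flat B q),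
    deg (flat B q) = 1%g & perm_eq (unzip1 p) (unzip1 q)].
  by case/splitPr: xq Rq q1 pq => q2 q3 *; exists q2, q3; split.
have [yx|yx] := eqVneq y.2 x.2.
  exists p; split=> //; suff -> : x = y by [].
  by case: x y xy yx {yp} => [? ?] [? ?] /= -> ->.
exists (pattern_star p); split; last exact: unzip1_star.
- rewrite mem_rev; apply/mapP; exists y => //.
  by case: x y xy yx {yp} => [? []] [? []] //= ->.
- by rewrite flat_star; apply: R_star.
by rewrite flat_star deg_star p1 tau1.
Qed.

(** The two parts of a word of degree 1 have inverse degrees, hence commute up to [R]. *)
Lemma loop_rotate_head B p x : deg (flat B p) = 1%g -> x.1 \in unzip1 p ->
  exists p', R (flat B p) (flat B (x :: p')) /\
    perm_eq (unzip1 p) (unzip1 (x :: p')).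
Proof.
move=> p1 /(loop_split p1)[q1 [q2 [Rq dq pq]]]; exists (q2 ++ q1); split.
  apply: (R_trans Rq); rewrite -cat_cons !flat_cat; apply: R_swap.
  by move: dq; rewrite flat_cat !deg_cat => /(canRL (mulKg _)) ->; rewrite mulg1 mulgV mulVg.
apply: (perm_trans pq); rewrite -cat_cons /unzip1 !map_cat.
by rewrite perm_catC.
Qed.

Lemma loop_rotate_last B p x : deg (flat B p) = 1%g -> x.1 \in unzip1 p ->
  exists p', R (flat B p) (flat B (p' ++ [:: x])) /\
    perm_eq (unzip1 p) (unzip1 (p' ++ [:: x])).
Proof.
move=> p1 /(loop_split p1)[q1 [q2 []]]; rewrite -cat_rcons -cats1.
move=> Rq dq pq; exists (q2 ++ q1); rewrite -catA; split.
  apply: (R_trans Rq); rewrite [X in R X _]flat_cat [X in R _ X]flat_cat; apply: R_swap.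
  by move: dq; rewrite flat_cat !deg_cat => /(canRL (mulKg _)) ->; rewrite mulg1 mulgV mulVg.
apply: (perm_trans pq); rewrite /unzip1 ![map _ (_ ++ (_ ++ _))]map_cat map_cat.
by rewrite perm_catC.
Qed.

(** The loop commutes with any word, as both orders have the degree of that word: it is brought to
    the front, then pushed to its new place. *)
Lemma loop_move s t s' t' e : deg e = 1%g -> s ++ t = s' ++ t' ->
  R (s ++ e ++ t) (s' ++ e ++ t').
Proof.
have front u v : deg e = 1%g -> R (e ++ u ++ v) (u ++ e ++ v).
  by move=> e1; rewrite !catA; apply: R_cat => //; apply: R_swap;
     rewrite !deg_cat e1 mulg1 mul1g.
move=> e1 st; apply: (R_trans (R_sym (front _ _ e1))).
by rewrite st; apply: front.
Qed.

(* Only the star of x is dictated by P ++ Q: the loop E can present y on either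
   side of x, with or without a star. *)
Lemma bring_adjacent B (P E Q : pattern) (x y : nat * bool) :
  deg (flat B E) = 1%g -> x.1 \in unzip1 (P ++ Q) -> y.1 \in unzip1 E ->
  exists q1 q2 (t : pattern), [/\ t = [:: x; y] \/ t = [:: flip y; flip x],
    R (flat B (P ++ E ++ Q)) (flat B (q1 ++ t ++ q2))
    & perm_eq (unzip1 (P ++ E ++ Q)) (unzip1 (q1 ++ t ++ q2))].
Proof.
move=> E1 /mapP[z zPQ xz] yE.
have [r1 [r2 defPQ]] : exists r1 r2, P ++ Q = r1 ++ z :: r2.
  by case/splitPr: zPQ => r1 r2; exists r1, r2.
(* If [x] has the required star, the loop goes right after it, rotated to begin with [y]. *)
have [zx|zx] := eqVneq z.2 x.2.
  have {}zx : z = x by case: x z xz zx {zPQ defPQ} => [? ?] [? ?] /= -> ->.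
  have [E' [RE pE]] := loop_rotate_head E1 yE.
  exists r1, (E' ++ r2), [:: x; y]; split; first by left.
    have -> : r1 ++ [:: x; y] ++ E' ++ r2 = (r1 ++ [:: x]) ++ (y :: E') ++ r2.
      by rewrite -!catA.
    apply: (@R_trans (flat B ((r1 ++ [:: x]) ++ E ++ r2))).
      rewrite !(flat_cat _ _ (_ ++ r2)) !(flat_cat _ _ (_ ++ Q)) !(flat_cat _ E).
      by apply: loop_move => //; rewrite -!flat_cat -catA cat1s defPQ zx.
    rewrite flat_cat [X in R _ X]flat_cat; apply: R_cat => //.
    by rewrite flat_cat [X in R _ X]flat_cat; apply: R_cat.
  apply/seq.permP => a; move/seq.permP/(_ a): pE.
  have := congr1 (fun r => count a (unzip1 r)) defPQ.
  rewrite /unzip1 !map_cat /= !count_cat /= ?map_cat ?count_cat zx; lia.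
(* Otherwise the loop goes right before [flip x], rotated to end with [flip y]. *)
have {}zx : z = flip x.
  by case: x z xz zx {zPQ defPQ} => [? []] [? []] //= ->.
have [E' [RE pE]] := @loop_rotate_last B E (flip y) E1 yE.
exists (r1 ++ E'), r2, [:: flip y; flip x]; split; first by right.
  have -> : (r1 ++ E') ++ [:: flip y; flip x] ++ r2 =
      r1 ++ (E' ++ [:: flip y]) ++ (flip x :: r2) by rewrite -!catA.
  apply: (@R_trans (flat B (r1 ++ E ++ (flip x :: r2)))).
    rewrite [flat _ (P ++ _)]flat_cat [flat _ (E ++ Q)]flat_cat.
    rewrite [flat _ (r1 ++ _)]flat_cat [flat _ (E ++ _)]flat_cat.
    by apply: loop_move => //; rewrite -!flat_cat defPQ zx.
  rewrite flat_cat [X in R _ X]flat_cat; apply: R_cat => //.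
  by rewrite flat_cat [X in R _ X]flat_cat; apply: R_cat.
apply/seq.permP => a; move/seq.permP/(_ a): pE.
have := congr1 (fun r => count a (unzip1 r)) defPQ.
rewrite /unzip1 !map_cat /= !count_cat /= ?map_cat ?count_cat zx /=; lia.
Qed.

(** Pigeonhole on the degrees of prefixes: two prefixes of equal degree differ by a factor of degree
    1. *)
Lemma exists_loop B p : (#|T| < size p)%N ->
  exists P E Q : pattern,
    [/\ p = P ++ E ++ Q, P != [::], E != [::] & deg (flat B E) = 1%g].
Proof.
(* Only nonempty prefixes are compared, so that [P] is nonempty. *)
move=> Tp; pose f (j : 'I_(size p)) := deg (flat B (take j.+1 p)).
have /injectivePn[i [j ij fij]] : ~~ injectiveb f.
  by apply: contraL Tp => /injectiveP/leq_card; rewrite card_ord -leqNgt.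
wlog {ij} ij : i j fij / (i < j)%N.
  move=> H; case: (ltngtP i j) => [|/H|/val_inj/eqP]; first exact: H.
    by apply.
  by rewrite (negbTE ij).
have E := cat_take_drop i.+1 (take j.+1 p).
exists (take i.+1 p), (drop i.+1 (take j.+1 p)), (drop j.+1 p).
rewrite take_takel in E; last by rewrite ltnS ltnW.
split.
- by rewrite catA E cat_take_drop.
- by rewrite -size_eq0 size_takel.
- by rewrite -size_eq0 size_drop size_takel // subn_eq0 -ltnNge ltnS.
apply: (mulgI (f i)); rewrite mulg1 {1}/f -deg_cat -flat_cat E.
exact: esym fij.
Qed.

(** * Fusing adjacent blocks *)

Definition set_block B (i : nat) (s : word) (k : nat) : word := if k == i then s else B k.

Lemma flat_set_block_out B i s p : i \notin unzip1 p -> flat (set_block B i s) p = flat B p.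
Proof.
move=> ip; congr flatten; apply/eq_in_map => x xp; rewrite /lit /set_block.
by case: eqP => // xi; rewrite -xi (map_f fst xp) in ip.
Qed.

Lemma flat_set_block B i s b p q : i \notin unzip1 p -> i \notin unzip1 q ->
  flat (set_block B i s) (p ++ (i, b) :: q) =
  flat B p ++ (if b then star s else s) ++ flat B q.
Proof.
move=> ip iq; rewrite flat_cat (flat_set_block_out _ _ ip).
rewrite -cat1s flat_cat (flat_set_block_out _ _ iq).
by rewrite flat1 /lit /= /set_block eqxx.
Qed.

(** The induction is on the number of blocks, not of symbols: two adjacent blocks are fused into
    one, as a block may be any nonempty word. Distinct indices tell the blocks inside a loop from
    those outside. *)
Lemma R_flat B p p' : (forall i, B i != [::]) -> uniq (unzip1 p) ->
  perm_eq (unzip1 p) (unzip1 p') -> deg (flat B p) = deg (flat B p') ->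
  (forall s t, R s t -> deg s = deg t) ->
  R (flat B p) (flat B p').
Proof.
move=> + + + + R_deg; have [n] := ubnP (size p).
elim: n => // n IH in B p p' * => pn B0 Up pp' dpp'.
case: (leqP (size p) #|T|) => [/R_short|Tp]; first exact.
have [P [E [Q [pE P0 E0 E1]]]] := exists_loop B Tp.
(* [E] and [P] are nonempty, so [p'] has letters inside and outside the loop, and somewhere two such
   letters are adjacent. *)
pose a := [pred x : nat * bool | x.1 \in unzip1 E].
have neq0_mem (q : pattern) : q != [::] -> exists z, z \in q.
  by case: q => // z q _; exists z; rewrite mem_head.
have ha : has a p'.
  have [e eE] := neq0_mem _ E0.
  have : e.1 \in unzip1 p'.
    by rewrite -(perm_mem pp') pE map_f // !mem_cat eE orbT.
  by case/mapP=> z zp' ez; apply/hasP; exists z; rewrite //= -ez map_f.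
have hc : has (predC a) p'.
  have [c cP] := neq0_mem _ P0.
  have : c.1 \in unzip1 p' by rewrite -(perm_mem pp') pE map_f // mem_cat cP.
  case/mapP=> z zp' cz; apply/hasP; exists z; rewrite //= -cz.
  move: Up; rewrite pE /unzip1 !map_cat cat_uniq => /and3P[_ /hasPn/(_ c.1)].
  rewrite mem_cat => H _; apply/negP => cE.
  by move: H; rewrite cE => /(_ isT)/negP[]; rewrite /= map_f.
have [p1 [x [y [p2 [p'E axy]]]]] := adjacent_change ha hc.
have Up' : uniq (unzip1 p') by rewrite -(perm_uniq pp').
have mem_p z : z.1 \in unzip1 p' -> z.1 \notin unzip1 E -> z.1 \in unzip1 (P ++ Q).
  rewrite -(perm_mem pp') pE /unzip1 !map_cat !mem_cat.
  by case: (_ \in map _ E); rewrite // !orbF.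
have xp' : x.1 \in unzip1 p' by rewrite p'E /unzip1 map_cat mem_cat mem_head orbT.
have yp' : y.1 \in unzip1 p'.
  by rewrite p'E /unzip1 map_cat mem_cat /= !inE eqxx !orbT.
have [q1 [q2 [t [tE Rt pt]]]] : exists q1 q2 (t : pattern),
    [/\ t = [:: x; y] \/ t = [:: flip y; flip x],
    R (flat B p) (flat B (q1 ++ t ++ q2))
    & perm_eq (unzip1 p) (unzip1 (q1 ++ t ++ q2))].
  rewrite pE; move: axy; rewrite /=; case xE: (x.1 \in unzip1 E) => /=.
    case yE: (y.1 \in unzip1 E) => // _.
    (* Here [x] lies in the loop and [y] outside; starring the pair exchanges their roles. *)
    have [||q1 [q2 [t [tE ? ?]]]] := @bring_adjacent B P E Q (flip y) (flip x) E1.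
    - by apply: mem_p; rewrite //= yE.
    - by rewrite xE.
    by exists q1, q2, t; rewrite !flipK in tE; split=> //; case: tE; [right|left].
  case yE: (y.1 \in unzip1 E) => // _.
  by apply: bring_adjacent => //; apply: mem_p; rewrite // xE.
apply: (R_trans Rt).
(* The pair becomes a single block under the index of [x]; [b] records whether the rewritten [p]
   contains it starred. *)
pose B' := set_block B x.1 (flat B [:: x; y]).
pose b := t != [:: x; y].
have tb : flat B t = if b then star (flat B [:: x; y]) else flat B [:: x; y].
  rewrite /b; case: eqP => [->//|]; case: tE => [->|->] // _.
  by rewrite -flat_star.
have Uq : uniq (unzip1 (q1 ++ t ++ q2)) by rewrite -(perm_uniq pt).
(* The index of [x] occurs nowhere else, so changing its block leaves the other letters alone. *)
have xq : x.1 \notin unzip1 q1 /\ x.1 \notin unzip1 q2.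
  have : count_mem x.1 (unzip1 (q1 ++ t ++ q2)) = 1%N.
    by rewrite count_uniq_mem // -(perm_mem pt) (perm_mem pp') xp'.
  rewrite /unzip1 !map_cat !count_cat => /addn3_eq1[].
    by case: tE => ->; rewrite /= eqxx ?addn1 // addnA addnC.
  by split; apply/count_memPn.
have xp : x.1 \notin unzip1 p1 /\ x.1 \notin unzip1 p2.
  have : count_mem x.1 (unzip1 p') = 1%N by rewrite count_uniq_mem // xp'.
  rewrite p'E /unzip1 !map_cat !count_cat => /addn3_eq1[]; first by rewrite /= eqxx.
  by split; apply/count_memPn.
have fq : flat B (q1 ++ t ++ q2) = flat B' (q1 ++ (x.1, b) :: q2).
  by rewrite flat_set_block ?xq.1 ?xq.2 // !flat_cat tb.
have fp : flat B p' = flat B' (p1 ++ (x.1, false) :: p2).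
  by rewrite flat_set_block ?xp.1 ?xp.2 // p'E !flat_cat.
have pq : perm_eq (unzip1 (q1 ++ (x.1, b) :: q2)) (unzip1 (p1 ++ (x.1, false) :: p2)).
  apply/seq.permP => c; have /seq.permP/(_ c) := pp'; have /seq.permP/(_ c) := pt.
  rewrite p'E /unzip1 !map_cat !count_cat /=.
  by case: tE => -> /=; clear; lia.
rewrite fq fp; apply: IH => //.
- have := perm_size pt; rewrite /unzip1 !size_map !size_cat /=.
  have : size t = 2%N by case: tE => ->.
  move: pn; clear; lia.
- move=> k; rewrite /B' /set_block; case: ifP => // _.
  rewrite -size_eq0 -cat1s flat_cat size_cat flat1 /lit addn_eq0 size_eq0.
  by case: x.2; rewrite ?star_eq0 (negbTE (B0 _)).
- have : uniq (y.1 :: unzip1 (q1 ++ (x.1, b) :: q2)).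
    rewrite (perm_uniq (_ : perm_eq _ (unzip1 (q1 ++ t ++ q2)))) //.
    apply/seq.permP => c; rewrite /unzip1 /= !map_cat !count_cat /=.
    by case: tE => -> /=; clear; lia.
  by case/andP.
by rewrite -fq -fp -(R_deg _ _ Rt).
Qed.

End Reduction.

(** * From identities to words *)

Section Kronecker.

(** Uniqueness of the expansion in base [M]: reduction modulo [M] compares the last digits, division
    by [M] the others. *)
Lemma digits_inj (M N : nat) (c d : nat -> nat) :
  (forall j, c j < M)%N -> (forall j, d j < M)%N ->
  (\sum_(j < N) c j * M ^ j = \sum_(j < N) d j * M ^ j)%N ->
  forall j, (j < N)%N -> c j = d j.
Proof.
elim: N c d => // N IH c d cM dM; rewrite !big_ord_recl !expn0 !muln1.
have shift (a : nat -> nat) : (\sum_(i < N) a (bump 0 i) * M ^ bump 0 i =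
    M * \sum_(i < N) a i.+1 * M ^ i)%N.
  by rewrite big_distrr; apply: eq_bigr => i _ /=; rewrite expnS mulnCA.
rewrite /= !shift => E.
have E0 : c 0 = d 0.
  have := congr1 (modn^~ M) E.
  by rewrite ![(_ + M * _)%N]addnC ![(M * _)%N]mulnC !modnMDl !modn_small.
move: E; rewrite E0 => /addnI/eqP; rewrite eqn_pmul2l ?(leq_ltn_trans _ (cM 0)) //.
move/eqP/(IH (c \o S) (d \o S) (fun j => cM j.+1) (fun j => dM j.+1)) => H.
by case=> // j /H.
Qed.

Lemma sum_count (N : nat) (s : seq nat) (w : nat -> nat) :
  all (fun x => x < N)%N s ->
  (\sum_(x <- s) w x = \sum_(j < N) count_mem (val j) s * w j)%N.
Proof.
elim: s => [|x s IH] /=; first by rewrite big_nil big1.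
case/andP=> xN sN; rewrite big_cons IH // 
  -[in LHS](_ : (\sum_(j < N) (x == j) * w j)%N = w x).
  by rewrite -big_split; apply: eq_bigr => j _ /=; rewrite mulnDl.
rewrite (bigD1 (Ordinal xN)) //= eqxx mul1n big1 ?addn0 // => j jx.
rewrite (_ : x == j = false) ?mul0n //.
by apply: contraNF jx => /eqP xj; apply/eqP/val_inj/esym.
Qed.

(** The digits of the sums in base [M] are the multiplicities, bounded by the lengths of the
    lists. *)
Lemma sum_expn_perm (M : nat) (s t : seq nat) : (size s < M)%N -> (size t < M)%N ->
  (\sum_(x <- s) M ^ x = \sum_(x <- t) M ^ x)%N -> perm_eq s t.
Proof.
move=> sM tM; pose N := (\max_(x <- s ++ t) x).+1.
have sN : all (fun x => x < N)%N (s ++ t).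
  by apply/allP => x xs; rewrite ltnS; exact: leq_bigmax_seq.
have [sN1 sN2] : all (fun x => x < N)%N s /\ all (fun x => x < N)%N t.
  by apply/andP; rewrite -all_cat.
rewrite !(@sum_count N) // => E.
have H := @digits_inj M N (fun j => count_mem j s) (fun j => count_mem j t) _ _ E.
apply/allP => x xst; apply/eqP; apply: H => [j|j|].
- exact: leq_ltn_trans (count_size _ _) sM.
- exact: leq_ltn_trans (count_size _ _) tM.
exact: (allP sN).
Qed.

(** In characteristic zero the naturals below [size q] would be distinct roots of a nonzero [q], one
    more than its degree allows. *)
Lemma poly_eq0_char0 (F : fieldType) (q : {poly F}) :
  [pchar F] =i pred0 -> (forall t, q.[t] = 0) -> q = 0.
Proof.
move=> /pcharf0P F0 q0; apply/eqP; apply/negPn/negP => qn0.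
have := @max_poly_roots _ q [seq n%:R : F | n <- iota 0 (size q)] qn0.
rewrite size_map size_iota ltnn => H; suff: false by []; apply: H.
  by apply/allP => t _; apply/rootP.
have le_inj (m n : nat) : m%:R = n%:R :> F -> (n <= m)%N.
  move=> mn; rewrite leqNgt; apply/negP => lt.
  have := F0 (n - m)%N; rewrite natrB 1?ltnW // mn subrr eqxx => /esym.
  by rewrite subn_eq0 leqNgt lt.
rewrite map_inj_uniq ?iota_uniq // => m n mn.
by apply/eqP; rewrite eqn_leq !le_inj.
Qed.

End Kronecker.

(** * Splitting an identity into binomials *)

Section Generation.
Variables (F : fieldType) (T : finGroupType) (sigma : cocycle2 F T).
Variables (tau : T -> T) (iota : {linear tgalg sigma -> tgalg sigma}).
Hypothesis charF0 : [pchar F] =i pred0.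
Hypothesis iota_inv : is_involution iota.
Hypothesis iota_tau : tau_homogeneous tau iota.
Local Notation A := (tgalg sigma).
Local Notation U := (ufreealg F T).
Local Notation L := (freealg F T).
Local Notation word := (seq (symb T)).
Local Notation mon := (@mon F T).
Local Notation deg := (deg tau).
Local Notation wX := (basis_eval iota).
Implicit Types (s t : word) (f h : L).

Definition letters s : seq (T * nat) := [seq x.1 | x <- s].

(** Otherwise a polynomial that vanishes everywhere would have a nonzero multiple of the coefficient
    of [w] in [f] among its coefficients. *)
Lemma isolated_word f (w : {fmonom (symb T)}) :
  graded_identity iota f -> w \in msupp f ->
  exists v : {fmonom (symb T)}, [/\ v \in msupp f, v != w,
    perm_eq (letters v) (letters w) & deg v = deg w].
Proof.
move=> f0 wf.
pose P (v : {fmonom (symb T)}) :=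
  [&& v != w, perm_eq (letters v) (letters w) & deg v == deg w].
case: (boolP (has P (msupp f))) => [/hasP[v vf /and3P[? ? /eqP ?]]|/hasPn Pf].
  by exists v; split.
(* [M] exceeds the length of each word of [f], so letter multiplicities are digits in base [M]. *)
pose M := (\max_(v <- msupp f) size (v : word)).+1.
pose e (s : word) : nat := (\sum_(x <- map choice.pickle (letters s)) M ^ x)%N.
pose sub (t : F) (g : T) (i : nat) : A :=
  t ^+ (M ^ choice.pickle (g, i))%N *: tgX sigma g.
have subE (t : F) s : weval iota (sub t) s = t ^+ e s *: wX s.
  rewrite /basis_eval /weval /e !big_map; elim: s => [|[[g i] b] s IH].
    by rewrite !big_nil expr0 scale1r.
  rewrite !big_cons IH exprD [t ^+ _ * _]mulrC -scalerA scalerAl scalerAr; congr (_ * _).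
    by case: b; rewrite /symb_eval /= /sub ?linearZ.
have ewE (v : {fmonom (symb T)}) (t : F) : 
    word_eval iota (sub t) v = t ^+ e v *: wX v by apply: subE.
pose d := deg w.
(* The coordinate at [d] of the value of [f], as a polynomial in the parameter [t]. *)
pose q : {poly F} := \sum_(v <- msupp f) (f@_v * wX v d) *: 'X^(e v).
have q0 : q = 0.
  apply: (poly_eq0_char0 charF0) => t; rewrite /q horner_sum.
  have /ffunP/(_ d) : free_eval iota (sub t) f = 0.
    by apply: f0 => g i; exists (t ^+ (M ^ choice.pickle (g, i))%N).
  rewrite free_evalE /lext sum_ffunE [RHS]ffunE => E0.
  transitivity (\sum_(v <- msupp f) (f@_v *: word_eval iota (sub t) v) d); last exact: E0.
  apply: eq_bigr => v _; rewrite hornerZ hornerXn ewE !tgZE.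
  by rewrite -mulrA [t ^+ _ * _]mulrC.
have /eqP := congr1 (fun r : {poly F} => r`_(e w)) q0.
have sz (v : {fmonom (symb T)}) : v \in msupp f -> (size (v : word) < M)%N.
  by move=> vf; rewrite ltnS; rewrite (big_rem v vf) leq_max leqnn.
rewrite coef0 /q coef_sum (bigD1_seq w) ?fset_uniq //= big_seq_cond big1 => [|v].
  rewrite addr0 coefZ coefXn eqxx mulr1 mulf_eq0 mcoeff_eq0 wf /=.
  have [c c0 ->] := basis_eval_nz iota_inv iota_tau w.
  by rewrite tgZE tgX_coef eqxx mulr1 (negbTE c0).
(* Another word with exponent [e w] has the letters of [w], hence by assumption another degree, and
   its coordinate at [d] is 0. *)
case/andP=> vf vw; rewrite coefZ coefXn; case: eqP => [evw|_]; last by rewrite mulr0.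
have vwP : perm_eq (letters v) (letters w).
  apply: (perm_map_inj (pcan_inj choice.pickleK)).
  by apply: (@sum_expn_perm M) => //; rewrite !size_map sz.
have [c _ ->] := basis_eval_nz iota_inv iota_tau v.
move: (Pf v vf); rewrite /P vw vwP /= eq_sym => /negbTE dvw.
by rewrite tgZE tgX_coef dvw !mulr0 mul0r.
Qed.

Section TidealOfIdentities.
Variable J : L -> Prop.
Hypothesis JT : is_Tideal tau J.
Hypothesis J_elem : forall f, elementary_identity tau iota f -> J f.
Hypothesis J_id : forall f, J f -> graded_identity iota f.

(** The blocks are single unstarred letters indexed by the positions in [s], which are distinct even
    when letters repeat. *)
Lemma weq_letters s t : perm_eq (letters s) (letters t) -> deg s = deg t -> weq J s t.
Proof.
move=> st dst; case: s st dst => [|x0 s'].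
  move=> /perm_size; rewrite /= size_map => /esym/size0nil -> _.
  exact: (weq_refl JT).
set s := x0 :: s' => st dst; pose K := letters s.
pose B j : word := [:: (nth x0.1 K j, false)].
have flatE Is (bs : seq bool) :
    flat B (zip Is bs) = zip [seq nth x0.1 K i | i <- Is] bs.
  elim: Is bs => [|i Is IH] [|b bs] //=.
  by rewrite -cat1s flat_cat IH; case: b.
have flatP (Is : seq nat) (t1 : word) : letters t1 = [seq nth x0.1 K i | i <- Is] ->
    flat B (zip Is [seq x.2 | x <- t1]) = t1 /\
    unzip1 (zip Is [seq x.2 | x <- t1]) = Is.
  move=> t1E; split; first by rewrite flatE -t1E; exact: zip_unzip.
  by apply: unzip1_zip; rewrite size_map -(size_map fst t1) [map _ _]t1E size_map.
have ts : perm_eq (letters t) K by rewrite perm_sym.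
have [Is pIs tE] := perm_iotaP x0.1 ts.
have [sf su] := flatP (seq.iota 0 (size K)) s (esym (mkseq_nth x0.1 K)).
have [tf tu] := flatP Is t tE.
rewrite -sf -tf.
apply: (R_flat (tau1 iota_inv iota_tau) (deg_star iota_inv iota_tau) (weq_refl JT)
  (weq_sym iota_inv iota_tau JT J_id) (weq_trans JT) (weq_cat JT)
  (weq_short iota_inv iota_tau JT J_elem)) => //.
- by rewrite su iota_uniq.
- by rewrite su tu perm_sym.
- by rewrite sf tf.
exact: (weq_deg iota_inv iota_tau J_id).
Qed.

(** Induction on the number of words in [f]: subtracting a multiple of a binomial in [J] removes [w]
    and involves only one other word [v], already in [f]. *)
Lemma graded_identity_inJ f : graded_identity iota f -> J f.
Proof.
have [n] := ubnP #|` msupp f|; elim: n => // n IH in f * => fn f0.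
have [fE|/fset0Pn[w wf]] := eqVneq (msupp f) fset0.
  suff -> : f = 0 by apply: Tideal0 JT.
  by apply: val_inj; apply/eqP; rewrite -msupp_eq0 fE.
have [v [vf vw lvw dvw]] := isolated_word f0 wf.
have [al [h Jh hE]] := weq_letters lvw dvw.
pose f' := f - f@_w *: h.
have Jwh : J (f@_w *: h) by apply: TidealZ JT _ _ Jh.
suff Jf' : J f' by rewrite -[f](subrK (f@_w *: h)); apply: TidealD JT _ _ Jf' Jwh.
have f'E u : (f' : U)@_u = f@_u - f@_w * ((w == u)%:R - al * (v == u)%:R).
  rewrite freealg_val_subZ hE mcoeffB mcoeffZ mcoeffB mcoeffZ !monE !mcoeffU.
  by rewrite !fmK.
apply: IH.
  apply: leq_trans (_ : #|` (msupp f `\ w)%fset| < n)%N; last first.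
    by move: fn; rewrite (cardfsD1 w) wf.
  apply/fsubset_leq_card/fsubsetP => u; rewrite in_fsetD1 -!mcoeff_neq0 f'E.
  have [->|uw] := eqVneq u w.
    by rewrite (negbTE vw) mulr0 subr0 mulr1 subrr eqxx.
  rewrite /= sub0r.
  have [<-|vu] := eqVneq v u; first by rewrite mcoeff_neq0.
  by rewrite mulr0 oppr0 mulr0 subr0.
have IdT := graded_identity_Tideal iota_inv iota_tau.
apply: (TidealD IdT f0); rewrite -scaleNr.
exact: (TidealZ IdT _ (J_id Jh)).
Qed.

End TidealOfIdentities.

End Generation.

Theorem theorem5 (F : fieldType) (T : finGroupType) (sigma : cocycle2 F T)
    (tau : T -> T) (iota : {linear tgalg sigma -> tgalg sigma})
    (charF0 : [pchar F] =i pred0)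
    (iota_inv : is_involution iota)
    (iota_tau : tau_homogeneous tau iota) :
  forall f : freealg F T,
    graded_identity iota f <-> Tideal_gen tau (elementary_identity tau iota) f.
Proof.
have IdT := graded_identity_Tideal iota_inv iota_tau.
have elemId := @elementary_graded_identity _ _ _ tau iota.
(* The generated ideal consists of identities because these form a T-ideal containing the elementary
   ones. *)
move=> f; split=> [f0 J JT J_elem|]; last by apply.
(* Once J consists of identities, the scalars in weq are nonzero. *)
pose J' (h : freealg F T) := J h /\ graded_identity iota h.
have J'T : is_Tideal tau J'.
  split.
  - by split; [apply: Tideal0 JT|apply: Tideal0 IdT].
  - by move=> g h [? ?] [? ?]; split; [apply: (TidealD JT)|apply: (TidealD IdT)].
  - by move=> k h [? ?]; split; [apply: (TidealZ JT)|apply: (TidealZ IdT)].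
  - by move=> g h [? ?]; split; [apply: (TidealMl JT)|apply: (TidealMl IdT)].
  - by move=> g h [? ?]; split; [apply: (TidealMr JT)|apply: (TidealMr IdT)].
  - by move=> h [? ?]; split; [apply: (Tideal_star JT)|apply: (Tideal_star IdT)].
  by move=> phi phiP h [? ?]; split; [apply: (Tideal_endo JT)|apply: (Tideal_endo IdT)].
suff [] : J' f by [].
apply: (graded_identity_inJ charF0 iota_inv iota_tau J'T _ _ f0) => h; last by case.
by move=> hE; split; [apply: J_elem|apply: elemId].
Qed.
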